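(* Let $I\in\mathcal I^1_{a,b}$, where $I=I_A$. Furthermore, let $g=\gcd(a,b)$. (i) Let $\gcd(A)=1$. Then the following conditions are equivalent: (a) $r(I^k)=1$ for some $k$. (b) $\{0,1,g-1,g\}\subseteq A$. (c) $r(I^k)=1$ for all $k\ge g-2$. (ii) If $r(I^{k_0})=1$, then $r(I^k)=1$ for $k\ge k_0$.
   Context: $K$ is a field, $a,b\ge1$ are integers, and the exponents $k,k_0$ are positive integers. For $\{0,g\}\subseteq A\subseteq[0,g]$, $g=\gcd(a,b)$, put $I_A=(x^{i\frac ag}y^{b-i\frac bg} : i\in A)\subset K[x,y]$. $\mathcal I^1_{a,b}$ is the set of all such ideals $I_A$; equivalently, the set of monomial ideals having $x^a,y^b$ among their minimal monomial generators and all of whose minimal monomial generators $x^cy^d$ satisfy $bc+ad=ab$. For $L\in\mathcal I^1_{a,b}$ the reduction number $r(L)$ is the smallest integer $r\ge0$ with $L^{r+1}=(x^a,y^b)L^r$ (such $r$ exists). If $I\in\mathcal I^1_{a,b}$ then $I^k\in\mathcal I^1_{ka,kb}$, so $r(I^k)$ is the reduction number of $I^k$ with respect to $(x^{ka},y^{kb})$. $[c,d]$ denotes the set of integers $i$ with $c\le i\le d$; $\gcd(A)$ is the greatest common divisor of the integers in $A$.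
   Formalization: In (i)(c) the case g = k = 1 is excluded: there I = (x^a, y^b), so r(I) = 0, while (a) (with k = 2) and (b) hold, so the equivalence as printed fails for g = 1; everything else is unchanged. *)

(* Defs.v *)
From HB Require Import structures.
From mathcomp Require Import all_boot all_order all_algebra.
From mathcomp Require Import mpoly.
Set Implicit Arguments.
Unset Strict Implicit.
Unset Printing Implicit Defensive.
Import GRing.Theory.
Local Open Scope ring_scope.

(* Ideals are Prop-valued predicates; two of them are compared extensionally
   (eq_ideal), so that no extensionality axiom is needed. *)
Definition eq_ideal (R : Type) (I J : R -> Prop) : Prop :=
  forall p : R, I p <-> J p.

(* The finite R-linear combinations of elements of S; u.1 is the coefficient
   and u.2 the element of S. *)
Definition ideal_gen (R : comNzRingType) (S : R -> Prop) : R -> Prop :=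
  fun p => exists s : seq (R * R),
    (forall u, u \in s -> S u.2) /\ p = \sum_(u <- s) u.1 * u.2.

Definition ideal_mul (R : comNzRingType) (I J : R -> Prop) : R -> Prop :=
  ideal_gen (fun p => exists u v : R, [/\ I u, J v & p = u * v]).

Fixpoint ideal_pow (R : comNzRingType) (I : R -> Prop) (n : nat) : R -> Prop :=
  if n is m.+1 then ideal_mul I (ideal_pow I m) else fun _ => True.

(* x^c y^d in K[x,y], with x and y the variables of index 0 and 1. *)
Definition monomial (K : fieldType) (c d : nat) : {mpoly K[2]} :=
  'X_(ord0 : 'I_2) ^+ c * 'X_(ord_max : 'I_2) ^+ d.

(* (x^a, y^b) *)
Definition ideal_xy (K : fieldType) (a b : nat) : {mpoly K[2]} -> Prop :=
  ideal_gen (fun p => p \in [:: monomial K a 0; monomial K 0 b]).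
Arguments ideal_xy : clear implicits.

(* A subset A of [0,g] is a set of ordinals below g + 1. For i in A the
   natural-number division and subtraction below are exact. *)
Definition ideal_A (K : fieldType) (a b : nat)
    (A : {set 'I_(gcdn a b).+1}) : {mpoly K[2]} -> Prop :=
  ideal_gen (fun p => exists2 i : 'I_(gcdn a b).+1, i \in A &
    p = monomial K (i * (a %/ gcdn a b)) (b - i * (b %/ gcdn a b))).
Arguments ideal_A : clear implicits.

Definition gcd_set (n : nat) (A : {set 'I_n}) : nat :=
  \big[gcdn/0%N]_(i in A) (i : nat).

Definition reduction_eq (K : fieldType) (a b : nat)
    (L : {mpoly K[2]} -> Prop) (r : nat) : Prop :=
  eq_ideal (ideal_pow L r.+1) (ideal_mul (ideal_xy K a b) (ideal_pow L r)).

(* r(L) = r, the reduction number being taken with respect to (x^a, y^b). *)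
Definition is_reduction_number (K : fieldType) (a b : nat)
    (L : {mpoly K[2]} -> Prop) (r : nat) : Prop :=
  reduction_eq a b L r /\ forall s : nat, reduction_eq a b L s -> (r <= s)%N.

(* Main.v *)
Require Import Defs.
From HB Require Import structures.
From mathcomp Require Import all_boot all_order all_algebra.
From mathcomp Require Import mpoly.
From mathcomp Require Import zify.

Import GRing.Theory.

(** Everything happens on the segment from y^b to x^a: the generators of I_A
are indexed by A, those of I_A^k by the k-fold sumset kA, a subset of [0,kg]
that contains 0 and kg.  Two ideals generated by monomials of one such segment
coincide exactly when their sets of exponents do ([eq_seg_ideal]), so that
L^(r+1) = (x^(ka), y^(kb)) L^r, for L = I_A^k, is the additive statement
(r+1)B = {0,m} + rB about B = kA and m = kg ([reduction_eq_seg]).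

For r = 0 it says B = {0,m}.  For r = 1 it says 2B = {0,m} + B: the set B is
closed under addition modulo m, so it is a subgroup of Z/m, and as it contains
A it contains d = gcd(A) as well.  Hence B consists of all the multiples of d
in [0,m], and conversely this equality of sets implies 2B = {0,m} + B
([full_of_sumset], [sumset_of_full]).  So r(I^k) = 1 means that kA is the set
of all multiples of d in [0,kg], and is not just {0,kg} ([reduction_number1]).

Now let d = 1.  If kA = [0,kg], then 1 and kg - 1 lie in kA, which forces
1 and g - 1 into A ([nfold_eq1], [nfold_pred]).  If 0, 1, g - 1, g lie in A,
then q copies of g - 1 or g and at most k - q copies of 1 produce the whole
interval from q(g-1) to qg + k - q; for k >= g - 2 consecutive intervals leave
no gap, so kA = [0,kg] ([full_of_four]).  For part (ii), as 0 and g are in A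
and d divides g, passing from kA to (k+1)A preserves the property of containing
all multiples of d ([full_nfoldS]); and g lies in kA strictly between 0 and kg
as soon as k > 1. *)

(** * Sumsets of sets of natural numbers *)

Definition sumset (S T : nat -> Prop) : nat -> Prop :=
  fun n => exists i j : nat, [/\ S i, T j & n = i + j].

Fixpoint nfold (S : nat -> Prop) (n : nat) : nat -> Prop :=
  if n is m.+1 then sumset S (nfold S m) else fun i => i = 0.

Definition elems (n : nat) (A : {set 'I_n}) : nat -> Prop :=
  fun i => exists2 j : 'I_n, j \in A & i = j.

Definition ends (N : nat) : nat -> Prop := fun i => i = 0 \/ i = N.

Definition bounded (N : nat) (S : nat -> Prop) : Prop :=
  forall i : nat, S i -> i <= N.

Lemma bounded_sumset (M N : nat) (S T : nat -> Prop) :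
  bounded M S -> bounded N T -> bounded (M + N) (sumset S T).
Proof. by move=> bS bT _ [i [j [/bS iM /bT jN ->]]]; apply: leq_add. Qed.

Lemma bounded_nfold (N n : nat) (S : nat -> Prop) :
  bounded N S -> bounded (n * N) (nfold S n).
Proof.
move=> bS; elim: n => [|n IHn] /=; first by move=> i ->.
by rewrite mulSn; apply: bounded_sumset.
Qed.

Lemma bounded_ends (N : nat) : bounded N (ends N).
Proof. by move=> i [->|->]. Qed.

Lemma dvdn_nfold (d n : nat) (S : nat -> Prop) :
  (forall i, S i -> d %| i) -> forall i, nfold S n i -> d %| i.
Proof.
move=> dS; elim: n => [|n IHn] i /=; first by move=> ->.
by move=> [j [l [/dS dj /IHn dl ->]]]; rewrite dvdn_add.
Qed.

Lemma nfold0 (n : nat) (S : nat -> Prop) : S 0 -> nfold S n 0.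
Proof. by move=> S0; elim: n => //= n IHn; exists 0, 0. Qed.

Lemma nfold_mul (n i : nat) (S : nat -> Prop) : S i -> nfold S n (n * i).
Proof.
by move=> Si; elim: n => //= n IHn; exists i, (n * i); rewrite mulSn.
Qed.

Lemma sub_nfold (n i : nat) (S : nat -> Prop) :
  S 0 -> 0 < n -> S i -> nfold S n i.
Proof.
case: n => // n S0 _ Si /=; exists i, 0.
by rewrite addn0; split=> //; apply: nfold0.
Qed.

(** A sum of natural numbers is 1 only if one summand is 1. *)
Lemma nfold_eq1 (n : nat) (S : nat -> Prop) : nfold S n 1 -> S 1.
Proof.
elim: n => //= n IHn [[|[|i]] [j [Si /= Sj def1]]].
- by apply: IHn; rewrite def1.
- by [].
- lia.
Qed.

(** Falling short of the maximal sum n * N by 1 is only possible with one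
summand N - 1, all the others being N. *)
Lemma nfold_pred (N n i : nat) (S : nat -> Prop) :
  bounded N S -> nfold S n i -> i.+1 = n * N -> S (N - 1).
Proof.
move=> bS; elim: n i => [|n IHn] //= _ [j [l [Sj Sl ->]]].
have jN := bS _ Sj; have lN := bounded_nfold _ n _ bS _ Sl.
rewrite mulSn => sum_jl.
have [eq_jN|neq_jN] := eqVneq j N; first by apply: (IHn l) => //; lia.
by rewrite (_ : N - 1 = j) //; lia.
Qed.

(** * Sets closed under addition modulo m *)

(** S is the inverse image of a submonoid of the finite group Z/m, that is, of a
subgroup: the negative coefficient in a Bezout relation can be made positive
by adding a multiple of m. *)
Lemma gcdn_closed (m : nat) (S : nat -> Prop) :
    0 < m -> S 0 -> (forall x y, S x -> S y -> S (x + y)) ->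
    (forall x, S (x + m) -> S x) ->
  forall x y, S x -> S y -> S (gcdn x y).
Proof.
move=> m0 S0 SD Sper x y Sx Sy.
have SM c z : S z -> S (c * z).
  by move=> Sz; elim: c => [|c IHc]; rewrite ?mul0n // mulSn; apply: SD.
have SperM c z : S (z + c * m) -> S z.
  elim: c => [|c IHc]; first by rewrite mul0n addn0.
  by rewrite mulSn addnCA addnC => /Sper.
have [->|x0] := posnP x; first by rewrite gcd0n.
have [u v bezout _] := egcdnP y x0.
apply: (SperM (v * y)).
(* - v * y is replaced by (m - 1) * (v * y), which is congruent to it mod m. *)
have -> : gcdn x y + v * y * m = u * x + (m - 1) * (v * y) by nia.
by apply: SD; [apply: SM | apply: (SM); apply: SM].
Qed.

(** The hypothesis 2B = {0,m} + B makes B closed under addition modulo m, where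
0 and m, both in B, stand for the same class; so the gcd of A is in B modulo m,
and all its multiples are. *)
Lemma full_of_sumset (m n : nat) (B : nat -> Prop) (A : {set 'I_n}) :
    0 < m -> bounded m B -> B 0 -> B m -> (forall i, elems n A i -> B i) ->
    (forall i, sumset B B i -> sumset (ends m) B i) ->
  forall i, i <= m -> gcd_set A %| i -> B i.
Proof.
move=> m0 bB B0 Bm AB BB i im /dvdnP[c def_i].
pose S i := B (i %% m).
have modB j : B j -> S j.
  move=> Bj; rewrite /S; have := bB _ Bj; rewrite leq_eqVlt.
  by case/orP => [/eqP->|jm]; rewrite ?modnn ?modn_small.
have S0 : S 0 by rewrite /S mod0n.
have SD x y : S x -> S y -> S (x + y).
  move=> Sx Sy; have [|j [l [ends_j Bl def_xy]]] := BB (x %% m + y %% m).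
    by exists (x %% m), (y %% m).
  rewrite /S -modnDm def_xy; have {}Bl := modB _ Bl.
  by case: ends_j => ->; rewrite ?add0n ?modnDl.
have Sper x : S (x + m) -> S x by rewrite /S modnDr.
have Sgcd : S (gcd_set A).
  rewrite /gcd_set; elim/big_ind: _ => [//|x y|j Aj].
    exact: (gcdn_closed m).
  by apply: modB; apply: AB; exists j.
have Si : S i.
  rewrite def_i; elim: (c) => [|c' IHc]; rewrite ?mul0n // mulSn.
  exact: SD.
move: im Si; rewrite leq_eqVlt => /orP[/eqP->//|im].
by rewrite /S modn_small.
Qed.

(** A sum of two elements of B that exceeds m is m plus a multiple of d in
[0,m]. *)
Lemma sumset_of_full (m d : nat) (B : nat -> Prop) :
    bounded m B -> B 0 -> B m -> (forall i, B i -> d %| i) ->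
    (forall i, i <= m -> d %| i -> B i) ->
  forall i, sumset B B i <-> sumset (ends m) B i.
Proof.
move=> bB B0 Bm dB fullB i; split=> [[j [l [Bj Bl ->]]]|[j [l [ends_j Bl ->]]]].
  have jm := bB _ Bj; have lm := bB _ Bl.
  have djl : d %| j + l by rewrite dvdn_add ?dB.
  have [jlm|mjl] := leqP (j + l) m.
    by exists 0, (j + l); split; [left | apply: fullB |].
  exists m, (j + l - m); split; [by right | | lia].
  by apply: fullB; [lia | apply: dvdn_sub djl (dB _ Bm)].
by exists j, l; split=> //; case: ends_j => ->.
Qed.

(** As k is positive, i is either at most k * g or at least
g, and adding 0 or g to an element of the k-fold sumset gives i. *)
Lemma full_nfoldS (d g k : nat) (S : nat -> Prop) :
    S 0 -> S g -> d %| g -> 0 < k ->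
    (forall i, i <= k * g -> d %| i -> nfold S k i) ->
  forall i, i <= k.+1 * g -> d %| i -> nfold S k.+1 i.
Proof.
move=> S0 Sg dg k0 fullS i; rewrite mulSn => i_le di.
have [ik|ki] := leqP i (k * g).
  by exists 0, i; split=> //; apply: fullS.
have gi : g <= i by nia.
exists g, (i - g); split=> //; last by rewrite subnKC.
by apply: fullS; [lia | rewrite dvdn_sub].
Qed.

(** * Sumsets of sets containing 0, 1, g - 1 and g *)

(** With q summands among g - 1 and g and at most k - q summands 1 one gets the
whole interval from q * (g - 1) to q * g + (k - q). *)
Lemma nfold_four (g k q n : nat) (S : nat -> Prop) :
    0 < g -> S 0 -> S 1 -> S (g - 1) -> S g ->
    q <= k -> q * (g - 1) <= n <= q * g + (k - q) ->
  nfold S k n.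
Proof.
move=> g0 S0 S1 Sg1 Sg; elim: k q n => [|k IHk] q n qk /andP[lo hi].
  by move: qk lo hi; rewrite leqn0 => /eqP-> /=; rewrite !mul0n; lia.
have [q_le|q_gt] := leqP q k.
  have [n_le|n_gt] := leqP n (q * g + (k - q)).
    by exists 0, n; split=> //; apply: (IHk q) => //; rewrite lo.
  exists 1, (n - 1); split=> //; last lia.
  by apply: (IHk q) => //; nia.
have def_q : q = k.+1 by lia.
move: lo hi; rewrite def_q subnn addn0 !mulSn => lo hi.
have [n_lt|n_ge] := ltnP n (g + k * g).
  exists (g - 1), (n - (g - 1)); split=> //; last by rewrite subnKC; nia.
  by apply: (IHk k) => //; rewrite subnn addn0; lia.
exists g, (k * g); split=> //; last lia.
by apply: (IHk k) => //; rewrite subnn addn0 leqnn leq_mul ?leq_subr.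
Qed.

(** The interval of index q + 1 begins at (q + 1) * (g - 1), which is at most 1
more than the end q * g + (k - q) of the previous one precisely if
g - 2 <= k. *)
Lemma full_of_four (g k : nat) (S : nat -> Prop) :
    0 < g -> S 0 -> S 1 -> S (g - 1) -> S g -> g - 2 <= k ->
  forall n, n <= k * g -> nfold S k n.
Proof.
move=> g0 S0 S1 Sg1 Sg gk n nk.
suff cover q : q <= k -> forall i, i <= q * g + (k - q) -> nfold S k i.
  by apply: (cover k) => //; rewrite subnn addn0.
elim: q => [_|q IHq qk] i hi.
  by apply: (nfold_four g k 0).
have [lo|lt_i] := leqP (q.+1 * (g - 1)) i.
  by apply: (nfold_four g k q.+1) => //; rewrite lo.
by apply: IHq; [lia | nia].
Qed.

(** * Products of ideals given by generators *)

Local Open Scope ring_scope.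

Lemma ideal_gen0 (R : comNzRingType) (S : R -> Prop) : ideal_gen S 0.
Proof. by exists [::]; rewrite big_nil. Qed.

Lemma ideal_genD (R : comNzRingType) (S : R -> Prop) (p q : R) :
  ideal_gen S p -> ideal_gen S q -> ideal_gen S (p + q).
Proof.
move=> [s [sS ->]] [t [tS ->]]; exists (s ++ t); split; last by rewrite big_cat.
by move=> u; rewrite mem_cat => /orP[/sS|/tS].
Qed.

Lemma ideal_genM (R : comNzRingType) (S : R -> Prop) (c p : R) :
  S p -> ideal_gen S (c * p).
Proof.
move=> Sp; exists [:: (c, p)]; split; last by rewrite big_seq1.
by move=> u; rewrite inE => /eqP->.
Qed.

Lemma mem_ideal_gen (R : comNzRingType) (S : R -> Prop) (p : R) :
  S p -> ideal_gen S p.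
Proof. by move=> Sp; rewrite -[p]mul1r; apply: ideal_genM. Qed.

Lemma ideal_gen_ind (R : comNzRingType) (S P : R -> Prop) :
    P 0 -> (forall p q, P p -> P q -> P (p + q)) ->
    (forall c p, S p -> P (c * p)) ->
  forall p, ideal_gen S p -> P p.
Proof.
move=> P0 PD PM _ [s [sS ->]]; rewrite big_seq.
by elim/big_ind: _ => // u /sS; apply: PM.
Qed.

Lemma ideal_gen_mull (R : comNzRingType) (S : R -> Prop) (c p : R) :
  ideal_gen S p -> ideal_gen S (c * p).
Proof.
elim/ideal_gen_ind: p / => [|p q|e p Sp].
- by rewrite mulr0; apply: ideal_gen0.
- by rewrite mulrDr; apply: ideal_genD.
by rewrite mulrA; apply: ideal_genM.
Qed.

Lemma ideal_gen_sub (R : comNzRingType) (S T : R -> Prop) :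
    (forall p, S p -> ideal_gen T p) ->
  forall p, ideal_gen S p -> ideal_gen T p.
Proof.
move=> ST; apply: ideal_gen_ind; first exact: ideal_gen0.
  exact: ideal_genD.
by move=> c p /ST; apply: ideal_gen_mull.
Qed.

Lemma eq_ideal_gen (R : comNzRingType) (S T : R -> Prop) :
  (forall p, S p <-> T p) -> eq_ideal (ideal_gen S) (ideal_gen T).
Proof.
by move=> ST p; split; apply: ideal_gen_sub => q /ST; apply: mem_ideal_gen.
Qed.

Lemma eq_ideal_mul (R : comNzRingType) (I I' J J' : R -> Prop) :
    eq_ideal I I' -> eq_ideal J J' ->
  eq_ideal (ideal_mul I J) (ideal_mul I' J').
Proof.
move=> eqI eqJ; apply: eq_ideal_gen => p.
by split=> [] [u [v [/eqI Iu /eqJ Jv ->]]]; exists u, v.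
Qed.

Lemma eq_ideal_pow (R : comNzRingType) (I I' : R -> Prop) (n : nat) :
  eq_ideal I I' -> eq_ideal (ideal_pow I n) (ideal_pow I' n).
Proof. by move=> eqI; elim: n => [|n IHn] //=; apply: eq_ideal_mul. Qed.

Lemma ideal_mul_gen (R : comNzRingType) (S T : R -> Prop) :
  eq_ideal (ideal_mul (ideal_gen S) (ideal_gen T))
    (ideal_gen (fun p => exists u v : R, [/\ S u, T v & p = u * v])).
Proof.
move=> p; split; apply: ideal_gen_sub => q [u [v [Su Tv ->]]]; last first.
  by apply: mem_ideal_gen; exists u, v; split=> //; apply: mem_ideal_gen.
elim/ideal_gen_ind: u / Su => [|u u'|c u Su].
- by rewrite mul0r; apply: ideal_gen0.
- by rewrite mulrDl; apply: ideal_genD.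
elim/ideal_gen_ind: v / Tv => [|v v'|e v Tv].
- by rewrite mulr0; apply: ideal_gen0.
- by rewrite mulrDr; apply: ideal_genD.
by rewrite mulrACA; apply: ideal_genM; exists u, v.
Qed.

(** * Monomial ideals in two variables *)

Lemma monomialM (K : fieldType) (c d c' d' : nat) :
  monomial K c d * monomial K c' d' = monomial K (c + c') (d + d').
Proof. by rewrite /monomial mulrACA -!exprD. Qed.

Lemma monomialE (K : fieldType) (c d : nat) :
  monomial K c d = 'X_[(U_(ord0) *+ c + U_(ord_max) *+ d)%MM].
Proof. by rewrite /monomial mpolyXD !mpolyXn. Qed.

(** Every monomial in the support of an element of a monomial ideal is divisible
by a generator; this is the property that passes to sums and multiples. *)
Lemma mem_monomial_ideal (K : fieldType) (E : nat -> nat -> Prop) (c d : nat) :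
    ideal_gen (fun p => exists c' d', E c' d' /\ p = monomial K c' d')
      (monomial K c d) ->
  exists c' d', [/\ E c' d', (c' <= c)%N & (d' <= d)%N].
Proof.
set p := monomial K c d => genp.
have : forall m, m \in msupp p ->
    exists c' d', [/\ E c' d', (c' <= m ord0)%N & (d' <= m ord_max)%N].
  elim/ideal_gen_ind: p / genp => [m|p q IHp IHq m|e p [c' [d' [Ecd ->]]] m].
  - by rewrite msupp0.
  - by move/msuppD_le; rewrite mem_cat => /orP[/IHp|/IHq].
  rewrite monomialE (perm_mem (msuppMX _ _)) => /mapP[m' _ ->].
  exists c', d'; split=> //; rewrite !mnmDE !mulmnE !mnm1E /= !(mul1n, mul0n).
    by rewrite -addnA leq_addr.
  by rewrite add0n leq_addr.
move/(_ (U_(ord0) *+ c + U_(ord_max) *+ d)%MM).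
rewrite /p monomialE msuppX inE eqxx => /(_ isT)[c' [d' [Ecd]]].
rewrite !mnmDE !mulmnE !mnm1E /= !(mul1n, mul0n) addn0 add0n => cc dd.
by exists c', d'.
Qed.

(** The ideal of exponents T on the segment from y^(N b) to x^(N a).  In the
application a and b are the quotients of the given exponents by their gcd.  The
subtraction is exact when T is bounded by N. *)
Definition seg_ideal (K : fieldType) (a b N : nat) (T : nat -> Prop) :
    {mpoly K[2]} -> Prop :=
  ideal_gen (fun p => exists2 i, T i & p = monomial K (i * a) ((N - i) * b)).

(** Distinct monomials of one segment do not divide each other, as the exponent
of x increases when that of y decreases: the generators are recovered from the
ideal. *)
Lemma eq_seg_ideal (K : fieldType) (a b N : nat) (S T : nat -> Prop) :
    (0 < a)%N -> (0 < b)%N -> bounded N S -> bounded N T ->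
  eq_ideal (seg_ideal K a b N S) (seg_ideal K a b N T) <->
    (forall i, S i <-> T i).
Proof.
move=> a0 b0 bS bT; split=> [eqST|eqST]; last first.
  by apply: eq_ideal_gen => p; split=> [] [i /eqST Ti ->]; exists i.
have sub U V : bounded N U -> bounded N V ->
    (forall p, seg_ideal K a b N U p -> seg_ideal K a b N V p) ->
    forall i, U i -> V i.
  move=> bU bV UV i Ui.
  pose E c d := exists2 j, V j & (c = j * a /\ d = (N - j) * b)%N.
  have /mem_monomial_ideal[_ [_ [[j Vj [-> ->]]]]] :
      ideal_gen (fun p => exists c d, E c d /\ p = monomial K c d)
        (monomial K (i * a) ((N - i) * b)).
    have /UV : seg_ideal K a b N U (monomial K (i * a) ((N - i) * b)).
      by apply: mem_ideal_gen; exists i.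
    apply: ideal_gen_sub => _ [j Vj ->]; apply: mem_ideal_gen.
    by exists (j * a)%N, ((N - j) * b)%N; split=> //; exists j.
  rewrite !leq_pmul2r // => ji Nij.
  have iN := bU _ Ui; have jN := bV _ Vj.
  by rewrite (_ : i = j) //; lia.
by move=> i; split; apply: sub => // p /eqST.
Qed.

Lemma seg_ideal_mul (K : fieldType) (a b M N : nat) (S T : nat -> Prop) :
    bounded M S -> bounded N T ->
  eq_ideal (ideal_mul (seg_ideal K a b M S) (seg_ideal K a b N T))
    (seg_ideal K a b (M + N) (sumset S T)).
Proof.
move=> bS bT p.
rewrite (ideal_mul_gen _ _ _ p); apply: eq_ideal_gen => {p} p.
have mulE i j : S i -> T j ->
    monomial K (i * a) ((M - i) * b) * monomial K (j * a) ((N - j) * b) =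
    monomial K ((i + j) * a) ((M + N - (i + j)) * b).
  move=> /bS iM /bT jN; rewrite monomialM -!mulnDl.
  by rewrite (_ : M - i + (N - j) = M + N - (i + j))%N //; lia.
split=> [[u [v [[i Si ->] [j Tj ->] ->]]]|[_ [i [j [Si Tj ->]]] ->]].
  by exists (i + j)%N; [exists i, j | apply: mulE].
exists (monomial K (i * a) ((M - i) * b)), (monomial K (j * a) ((N - j) * b)).
by rewrite mulE //; split=> //; [exists i | exists j].
Qed.

Lemma seg_ideal_pow (K : fieldType) (a b N n : nat) (S : nat -> Prop) :
    bounded N S ->
  eq_ideal (ideal_pow (seg_ideal K a b N S) n)
    (seg_ideal K a b (n * N) (nfold S n)).
Proof.
move=> bS; elim: n => [|n IHn] p /=.
  split=> // _; rewrite -[p]mulr1; apply: ideal_genM; exists 0%N => //.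
  by rewrite /monomial !mul0n !expr0 mulr1.
rewrite mulSn -(seg_ideal_mul K a b _ _ _ _ bS (bounded_nfold _ n _ bS) p).
by apply: eq_ideal_mul.
Qed.

Lemma ideal_xy_seg (K : fieldType) (a b N : nat) :
  eq_ideal (ideal_xy K (N * a) (N * b)) (seg_ideal K a b N (ends N)).
Proof.
apply: eq_ideal_gen => p; rewrite !inE; split.
  case/orP=> /eqP->.
    by exists N; rewrite ?subnn; [right | rewrite mul0n].
  by exists 0%N; rewrite ?subn0; [left | rewrite mul0n].
by case=> i [-> ->|-> ->]; rewrite ?subn0 ?subnn !mul0n eqxx ?orbT.
Qed.

(** Both sides of the reduction equation are ideals of the segment of length
(r + 1) * N, so they can be compared through their exponents. *)
Lemma reduction_eq_seg (K : fieldType) (a b N r : nat) (B : nat -> Prop)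
    (L : {mpoly K[2]} -> Prop) :
    (0 < a)%N -> (0 < b)%N -> bounded N B ->
    eq_ideal L (seg_ideal K a b N B) ->
  reduction_eq (N * a) (N * b) L r <->
    (forall i, nfold B r.+1 i <-> sumset (ends N) (nfold B r) i).
Proof.
move=> a0 b0 bB eqL.
have bBr n : bounded (n * N) (nfold B n) by apply: bounded_nfold.
have bEr : bounded (r.+1 * N) (sumset (ends N) (nfold B r)).
  by rewrite mulSn; apply: bounded_sumset => //; apply: bounded_ends.
rewrite -(eq_seg_ideal K a b _ _ _ a0 b0 (bBr r.+1) bEr).
have powE n : eq_ideal (ideal_pow L n) (seg_ideal K a b (n * N) (nfold B n)).
  move=> p; rewrite -(seg_ideal_pow K a b N n B bB p).
  exact: (eq_ideal_pow _ _ _ n eqL).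
have rhsE : eq_ideal (ideal_mul (ideal_xy K (N * a) (N * b)) (ideal_pow L r))
    (seg_ideal K a b (r.+1 * N) (sumset (ends N) (nfold B r))).
  move=> p; rewrite mulSn.
  rewrite -(seg_ideal_mul K a b _ _ _ _ (@bounded_ends N) (bBr r) p).
  by apply: eq_ideal_mul; [apply: ideal_xy_seg | apply: powE].
by split=> eqr p; move: (eqr p); rewrite (powE r.+1 p) (rhsE p).
Qed.

(** * The reduction number of a power *)

Local Close Scope ring_scope.

Lemma bounded_elems (g : nat) (A : {set 'I_g.+1}) : bounded g (elems g.+1 A).
Proof. by move=> _ [i _ ->]; rewrite -ltnS. Qed.

Lemma sumset0r (S T : nat -> Prop) :
  (forall i, T i <-> i = 0) -> forall i, sumset S T i <-> S i.
Proof.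
move=> T0 i; split=> [[j [l [Sj /T0-> ->]]]|Si]; first by rewrite addn0.
by exists i, 0; rewrite addn0; split=> //; apply/T0.
Qed.

(** The first condition is r <= 1; the second one excludes r = 0, where
I^k = (x^(ka), y^(kb)). *)
Lemma reduction_number1 (K : fieldType) (a b k : nat)
    (A : {set 'I_(gcdn a b).+1}) :
    0 < a -> 0 < b -> [set ord0; ord_max] \subset A -> 0 < k ->
  let g := gcdn a b in
  let B := nfold (elems g.+1 A) k in
  is_reduction_number (k * a) (k * b) (ideal_pow (ideal_A K a b A) k) 1 <->
    (forall i, i <= k * g -> gcd_set A %| i -> B i) /\
    ~ (forall i, B i -> ends (k * g) i).
Proof.
move=> a0 b0 hA k0 g B.
have g0 : 0 < g by rewrite gcdn_gt0 a0.
have def_a : a = g * (a %/ g) by rewrite mulnC divnK ?dvdn_gcdl.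
have def_b : b = g * (b %/ g) by rewrite mulnC divnK ?dvdn_gcdr.
have a'0 : 0 < a %/ g by rewrite divn_gt0 // dvdn_leq ?dvdn_gcdl.
have b'0 : 0 < b %/ g by rewrite divn_gt0 // dvdn_leq ?dvdn_gcdr.
have A0 : elems g.+1 A 0.
  by exists ord0 => //; apply: (subsetP hA); rewrite !inE eqxx.
have Ag : elems g.+1 A g.
  by exists ord_max => //; apply: (subsetP hA); rewrite !inE eqxx orbT.
have bA := bounded_elems g A.
have bB : bounded (k * g) B by apply: bounded_nfold.
have B0 : B 0 by apply: nfold0.
have Bm : B (k * g) by apply: nfold_mul.
have AB i : elems g.+1 A i -> B i by apply: sub_nfold.
have dB : forall i, B i -> gcd_set A %| i.
  by apply: dvdn_nfold => _ [i Ai ->]; apply: (biggcdn_inf i).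
have eqI : eq_ideal (ideal_A K a b A)
    (seg_ideal K (a %/ g) (b %/ g) g (elems g.+1 A)).
  apply: eq_ideal_gen => p; split=> [[i Ai ->]|[_ [i Ai ->] ->]].
    by exists i; [exists i | rewrite mulnBl -def_b].
  by exists i => //; rewrite mulnBl -def_b.
have eqIk : eq_ideal (ideal_pow (ideal_A K a b A) k)
    (seg_ideal K (a %/ g) (b %/ g) (k * g) B).
  move=> p; rewrite -(seg_ideal_pow K _ _ g k _ bA p).
  exact: (eq_ideal_pow _ _ _ k eqI).
have redE r := reduction_eq_seg K _ _ _ r B _ a'0 b'0 bB eqIk.
rewrite -!mulnA -def_a -def_b in redE.
have nfold1 : forall i, nfold B 1 i <-> B i by apply: sumset0r.
have red0 : reduction_eq (k * a) (k * b) (ideal_pow (ideal_A K a b A) k) 0 <->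
    (forall i, B i -> ends (k * g) i).
  rewrite redE; split=> eqB i.
    by move/nfold1/eqB/(sumset0r (ends (k * g)) (nfold B 0)); apply.
  rewrite nfold1 (sumset0r (ends (k * g)) (nfold B 0)) //.
  by split=> [/eqB|[->|->]].
have red1 : reduction_eq (k * a) (k * b) (ideal_pow (ideal_A K a b A) k) 1 <->
    (forall i, i <= k * g -> gcd_set A %| i -> B i).
  have sumset1 S i : sumset S (nfold B 1) i <-> sumset S B i.
    by split=> [] [j [l [Sj /nfold1 Bl ->]]]; exists j, l.
  rewrite redE; split=> [eqB|fullB i].
    apply: (full_of_sumset (k * g) _ _ A) => //; first by rewrite muln_gt0 k0.
    by move=> i /sumset1/(eqB i)/sumset1.
  rewrite -[nfold B 2 i]/(sumset B (nfold B 1) i) !sumset1.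
  exact: sumset_of_full fullB i.
rewrite /is_reduction_number red1; split=> [[fullB min1]|[fullB notends]].
  by split=> // /red0/min1.
by split=> // -[|s] // /red0.
Qed.

(* In (c) the pair g = k = 1 is left out: there I = (x^a, y^b) and r(I) = 0,
   while (a) and (b) hold. As k is positive, truncation in g - 2 is harmless. *)
Theorem theorem7p2 (K : fieldType) (a b : nat) (ha : 0 < a) (hb : 0 < b)
    (A : {set 'I_(gcdn a b).+1}) (hA : [set ord0; ord_max] \subset A) :
  let g := gcdn a b in
  let I := ideal_A K a b A in
  let r_pow_eq1 (k : nat) :=
    is_reduction_number (k * a) (k * b) (ideal_pow I k) 1 in
  (gcd_set A = 1 ->
    [<-> exists2 k : nat, 0 < k & r_pow_eq1 k;
         [set ord0; inord 1; inord (g - 1); ord_max] \subset A;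
         forall k : nat, 0 < k -> g - 2 <= k -> (g, k) <> (1, 1) ->
           r_pow_eq1 k])
  /\
  (forall k0 : nat, 0 < k0 -> r_pow_eq1 k0 ->
     forall k : nat, k0 <= k -> r_pow_eq1 k).
Proof.
move=> g I r_pow_eq1.
have g0 : 0 < g by rewrite gcdn_gt0 ha.
have A0 : elems g.+1 A 0.
  by exists ord0 => //; apply: (subsetP hA); rewrite !inE eqxx.
have Ag : elems g.+1 A g.
  by exists ord_max => //; apply: (subsetP hA); rewrite !inE eqxx orbT.
have rE k (k0 : 0 < k) : r_pow_eq1 k <->
    (forall i, i <= k * g -> gcd_set A %| i -> nfold (elems g.+1 A) k i) /\
    ~ (forall i, nfold (elems g.+1 A) k i -> ends (k * g) i).
  exact: reduction_number1.
have elemsP i : i <= g -> elems g.+1 A i <-> inord i \in A.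
  move=> ig; split=> [[j Aj ->]|Ai]; first by rewrite inord_val.
  by exists (inord i) => //; rewrite inordK.
split=> [gcdA|k0 k0_gt0 /(rE _ k0_gt0)[full0 notends0] k].
  tfae.
  - case=> k k0 /(rE _ k0)[fullA _].
    have A1 : elems g.+1 A 1.
      by apply: (nfold_eq1 k); apply: fullA; rewrite ?gcdA ?muln_gt0 ?k0.
    have Ag1 : elems g.+1 A (g - 1).
      apply: (nfold_pred g k (k * g).-1); first exact: bounded_elems.
        by apply: fullA; rewrite ?gcdA ?leq_pred.
      by rewrite prednK // muln_gt0 k0.
    apply/subsetP => i; rewrite !inE -!orbA.
    case/or4P => /eqP->; last 1 first.
    + by apply: (subsetP hA); rewrite !inE eqxx orbT.
    + by apply: (subsetP hA); rewrite !inE eqxx.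
    + exact/elemsP.
    + by apply/elemsP=> //; apply: leq_subr.
  - move=> /subsetP fourA k k0 gk neq11; apply/(rE _ k0).
    have A1 : elems g.+1 A 1.
      by apply/elemsP => //; apply: fourA; rewrite !inE eqxx !orbT.
    have Ag1 : elems g.+1 A (g - 1).
      apply/elemsP; first exact: leq_subr.
      by apply: fourA; rewrite !inE eqxx !orbT.
    (* If 1 is in {0, kg}, then kg = 1. *)
    split=> [i ik _|/(_ 1)[]]; first exact: (full_of_four g k).
    + exact: sub_nfold.
    + by [].
    + by move=> kg; apply: neq11; congr (_, _); nia.
  (* A witness that is at least 2 stays clear of the case g = k = 1. *)
  - move=> rA; have gk : g - 2 <= (g - 2).+2 by lia.
    have neq11 : (g, (g - 2).+2) <> (1, 1) by case.
    by exists (g - 2).+2 => //; apply: (rA (g - 2).+2 isT gk neq11).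
rewrite leq_eqVlt => /orP[/eqP<-|k0k]; first exact/rE.
have k_gt0 : 0 < k by lia.
apply/rE => //; split; last first.
  (* As k > k0 > 0, the element g of kA lies strictly between 0 and kg. *)
  move/(_ g)/(_ (sub_nfold _ _ _ A0 k_gt0 Ag)) => [] g_eq; nia.
have dg : gcd_set A %| g.
  apply: (biggcdn_inf ord_max) => //; apply: (subsetP hA).
  by rewrite !inE eqxx orbT.
rewrite -(subnKC (ltnW k0k)); elim: (k - k0) => [|n IHn].
  by rewrite addn0.
rewrite addnS; apply: full_nfoldS => //; lia.
Qed.
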